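(* Let $\Omega\colon U\to V$ be a linear operator with the Gurarii property, where $U,V$ are separable Banach spaces. Then both $U$ and $V$ are linearly isometric to the Gurarii space $\mathbb G$.
   Context: All Banach spaces are real. Nonexpansive means of norm $\le 1$. An $\varepsilon$-embedding is a linear operator $f\colon X\to Y$ between Banach spaces with $(1+\varepsilon)^{-1}\|x\|\le\|f(x)\|\le\|x\|$ for all $x\in X$. The Gurarii space $\mathbb G$ is the unique (up to linear isometry) separable Banach space such that, given finite-dimensional Banach spaces $X\subseteq Y$ and $\varepsilon>0$, every isometric embedding $i\colon X\to\mathbb G$ extends to an $\varepsilon$-embedding $j\colon Y\to\mathbb G$. A linear operator $\Omega\colon U\to V$ between Banach spaces has the Gurarii property if $\|\Omega\|\le 1$ and: given $\varepsilon>0$, a nonexpansive operator $T\colon X\to Y$ between finite-dimensional Banach spaces, subspaces $X_0\subseteq X$, $Y_0\subseteq Y$ with $T[X_0]\subseteq Y_0$, and isometric embeddings $i\colon X_0\to U$, $j\colon Y_0\to V$ with $\Omega\circ i=j\circ(T\restriction X_0)$, there exist $\varepsilon$-embeddings $i'\colon X\to U$, $j'\colon Y\to V$ with $\|i'\restriction X_0-i\|<\varepsilon$, $\|j'\restriction Y_0-j\|<\varepsilon$ and $\|\Omega\circ i'-j'\circ T\|<\varepsilon$.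
   Formalization: In the definition of the Gurarii space, the extension j satisfies (1+ε)^{-1}‖y‖ ≤ ‖j(y)‖ ≤ (1+ε)‖y‖ (the standard bound) instead of ‖j(y)‖ ≤ ‖y‖, because no separable Banach space admits exact nonexpansive extensions of this kind. *)

(* Defs.v *)
From HB Require Import structures.
From mathcomp Require Import all_boot all_order all_algebra.
From mathcomp Require Import all_classical all_reals all_analysis.

Set Implicit Arguments.
Unset Strict Implicit.
Unset Printing Implicit Defensive.

Import Order.TTheory GRing.Theory Num.Theory.
Import numFieldNormedType.Exports.

Local Open Scope classical_set_scope.
Local Open Scope ring_scope.

(* A Banach space is a [completeNormedModType R] with [R : realType].         *)

Definition separable (R : realType) (X : normedModType R) : Prop :=
  exists2 D : set X, countable D & dense D.

(* Finite-dimensional normed spaces over [R] are complete, so finite-         *)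
(* dimensional Banach spaces are the [normedModType]s satisfying this.        *)
Definition finite_dim (R : realType) (X : normedModType R) : Prop :=
  exists (n : nat) (b : 'I_n -> X),
    forall x : X, exists c : 'I_n -> R, x = \sum_(k < n) c k *: b k.

(* An operator defined on a subspace [X0] of [X] is represented by a function *)
(* on [X] of which only the values on [X0] are ever used.                     *)
Definition linear_on (R : realType) (X Y : normedModType R) (X0 : {pred X})
    (f : X -> Y) : Prop :=
  forall a : R, {in X0 &, forall x y : X, f (a *: x + y) = a *: f x + f y}.

Definition isometric_embedding_on (R : realType) (X Y : normedModType R)
    (X0 : {pred X}) (f : X -> Y) : Prop :=
  linear_on X0 f /\ {in X0, forall x : X, `|f x| = `|x|}.

(* The operator norm of the restriction of [f] to [X0], in the extended reals *)
(* so that unbounded operators get the norm [+oo].                            *)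
Definition opnorm_on (R : realType) (X Y : normedModType R) (X0 : {pred X})
    (f : X -> Y) : \bar R :=
  ereal_sup [set (`|f x|)%:E | x in [set x : X | x \in X0 /\ `|x| <= 1]].

Definition opnorm (R : realType) (X Y : normedModType R) (f : X -> Y) : \bar R :=
  opnorm_on predT f.

Definition eps_embedding (R : realType) (X Y : normedModType R) (eps : R)
    (f : {linear X -> Y}) : Prop :=
  forall x : X, (1 + eps)^-1 * `|x| <= `|f x| <= `|x|.

(* In the extension property of the Gurarii space the upper bound has to be   *)
(* [(1 + eps) * `|x|]: no separable Banach space admits exact extensions that *)
(* are moreover nonexpansive.                                                 *)
Definition gurarii_space (R : realType) (G : completeNormedModType R) : Prop :=
  separable G /\
  forall (Y : normedModType R) (X : {pred Y}) (eps : R) (i : Y -> G),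
    finite_dim Y -> submod_closed X -> 0 < eps ->
    isometric_embedding_on X i ->
    exists j : {linear Y -> G},
      {in X, j =1 i} /\
      (forall y : Y, (1 + eps)^-1 * `|y| <= `|j y| <= (1 + eps) * `|y|).

Definition gurarii_property (R : realType) (U V : completeNormedModType R)
    (Omega : {linear U -> V}) : Prop :=
  (opnorm Omega <= 1)%E /\
  forall (eps : R) (X Y : normedModType R) (T : {linear X -> Y})
      (X0 : {pred X}) (Y0 : {pred Y}) (i : X -> U) (j : Y -> V),
    0 < eps -> finite_dim X -> finite_dim Y -> (opnorm T <= 1)%E ->
    submod_closed X0 -> submod_closed Y0 ->
    {in X0, forall x : X, T x \in Y0} ->
    isometric_embedding_on X0 i -> isometric_embedding_on Y0 j ->
    {in X0, forall x : X, Omega (i x) = j (T x)} ->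
    exists (i' : {linear X -> U}) (j' : {linear Y -> V}),
      [/\ eps_embedding eps i', eps_embedding eps j',
          (opnorm_on X0 (fun x : X => i' x - i x)%R < eps%:E)%E,
          (opnorm_on Y0 (fun y : Y => j' y - j y)%R < eps%:E)%E &
          (opnorm (fun x : X => Omega (i' x) - j' (T x))%R < eps%:E)%E].

Definition linearly_isometric (R : realType) (X Y : normedModType R) : Prop :=
  exists f : {linear X -> Y}, bijective f /\ (forall x : X, `|f x| = `|x|).

(* Main.v *)
(* [V] is almost extensible (isometric embeddings of subspaces extend approximately
   to finite-dimensional superspaces) by the Gurarii property with [T = 0].  For
   [U], given [X] inside [Y] and an isometric [i] from [X] to [U], the operator
   [Omega \o i] extends from [X] to [Y] with values in a pushout, which makes the
   Gurarii property applicable.  Bounded projections in finite dimension correct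
   approximate extensions into exact ones, so [U] and [V] are Gurarii spaces.
   Uniqueness of the Gurarii space is the back-and-forth argument of Kubis and
   Solecki: an [eps]-isometry between finite-dimensional spaces becomes
   [eps]-close to the inclusion in a suitable norm on their direct sum.  It is run
   on finite sequences of vectors in place of subspaces: both sequences grow and
   are perturbed by summable amounts, and their limits are dense and isometric. *)
Require Import Defs.
From HB Require Import structures.
From mathcomp Require Import all_boot all_order all_algebra.
From mathcomp Require Import all_classical all_reals all_analysis.
From mathcomp Require Import ring lra zify.
Import Order.TTheory GRing.Theory Num.Theory.
Import numFieldNormedType.Exports.
Local Open Scope classical_set_scope.
Local Open Scope ring_scope.
Set Implicit Arguments.
Unset Strict Implicit.

(** * Finite-dimensional spaces *)

Lemma exists_linear (K : pzRingType) (M N : lmodType K) (f : M -> N) :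
  linear f -> exists F : {linear M -> N}, F =1 f.
Proof.
move=> lin_f; pose mix := GRing.isLinear.Build K M N _ f lin_f.
by exists (HB.pack_for {linear M -> N} f mix).
Qed.

(** Coefficients form a row vector because ['rV[R]_m] is itself a normed space with compact unit
    sphere, which drives the estimates below. *)
Definition lincomb (K : pzRingType) (M : lmodType K) (m : nat) (c : 'I_m -> M)
  (v : 'rV[K]_m) : M := \sum_k v ord0 k *: c k.

Lemma lincomb_is_linear (K : pzRingType) (M : lmodType K) (m : nat)
  (c : 'I_m -> M) : linear (@lincomb K M m c).
Proof.
move=> a u v; rewrite /lincomb scaler_sumr -big_split /=; apply: eq_bigr => k _.
by rewrite !mxE scalerDl scalerA.
Qed.

HB.instance Definition _ (K : pzRingType) (M : lmodType K) (m : nat)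
    (c : 'I_m -> M) :=
  GRing.isLinear.Build K 'rV[K]_m M _ (@lincomb K M m c)
    (@lincomb_is_linear K M m c).

Lemma lincomb_delta (K : pzRingType) (M : lmodType K) (m : nat) (c : 'I_m -> M)
  (k : 'I_m) : lincomb c (delta_mx ord0 k) = c k.
Proof.
rewrite /lincomb (bigD1 k) //= mxE !eqxx scale1r big1 ?addr0 // => i ik.
by rewrite mxE eqxx (negbTE ik) scale0r.
Qed.

Lemma lincomb_lift (K : pzRingType) (M : lmodType K) (m : nat)
    (c : 'I_m.+1 -> M) (k : 'I_m.+1) (v : 'rV[K]_m.+1) : v ord0 k = 0 ->
  lincomb c v = lincomb (c \o lift k) (col' k v).
Proof.
move=> vk0; rewrite /lincomb (bigD1_ord k) //= vk0 scale0r add0r.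
by apply: eq_bigr => i _; rewrite mxE.
Qed.

Lemma lincomb_comp (K : pzRingType) (M : lmodType K) (m n : nat)
    (b : 'I_m -> M) (c : 'I_n -> M) (v : 'rV[K]_m) :
  (forall k, exists w, b k = lincomb c w) -> exists w, lincomb b v = lincomb c w.
Proof.
move=> /choice[w bE]; exists (lincomb w v).
rewrite [lincomb w v]/lincomb linear_sum; apply: eq_bigr => k _.
by rewrite linearZ /= bE.
Qed.

(* A family of least length spanning the space modulo [X] is free modulo [X]. *)
Lemma free_modulo (K : fieldType) (M : lmodType K) (X : {pred M}) (n : nat)
    (b : 'I_n -> M) : submod_closed X ->
  exists (m : nat) (c : 'I_m -> M),
    [/\ forall k, exists w, c k = lincomb b w,
        forall v, exists w, lincomb b v - lincomb c w \in X &
        forall v, lincomb c v \in X -> v = 0].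
Proof.
move=> Xsub; have [X0 XD] := Xsub.
pose P m := exists c : 'I_m -> M,
  (forall k, exists w, c k = lincomb b w) /\
  forall v, exists w, lincomb b v - lincomb c w \in X.
have exP : exists m, `[< P m >].
  exists n; apply/asboolP; exists b; split.
    by move=> k; exists (delta_mx ord0 k); rewrite lincomb_delta.
  by move=> v; exists v; rewrite subrr.
case: (ex_minnP exP) => m /asboolP[c [cb bc]] min_m {exP}.
exists m, c; split => // v cvX; apply/eqP/negPn/negP => v_neq0.
have [k vk_neq0] : exists k, v ord0 k != 0.
  apply/existsP; rewrite -negb_forall; apply: contra v_neq0 => /forallP v0.
  by apply/eqP/rowP => k; rewrite mxE; apply/eqP.
case: m => [|m] in c cb bc min_m v cvX v_neq0 k vk_neq0 *.
  by case: k {vk_neq0}.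
have /min_m : `[< P m >]; last by rewrite ltnn.
apply/asboolP; exists (c \o lift k); split => [j|u]; first exact: cb.
have [w uwX] := bc u.
pose w' := w - (w ord0 k / v ord0 k) *: v.
have w'k : w' ord0 k = 0 by rewrite !mxE divfK // subrr.
exists (col' k w'); rewrite -lincomb_lift // linearB linearZ /= opprB addrCA.
exact: XD.
Qed.

Lemma submod_closed0 (K : pzRingType) (M : lmodType K) :
  submod_closed (pred1 (0 : M)).
Proof.
by split; [rewrite inE | move=> a x y /eqP-> /eqP->; rewrite scaler0 addr0 inE].
Qed.

Lemma exists_basis (K : fieldType) (M : lmodType K) (n : nat) (b : 'I_n -> M) :
  exists (m : nat) (c : 'I_m -> M),
    [/\ forall k, exists w, c k = lincomb b w,
        forall v, exists w, lincomb b v = lincomb c w &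
        forall v, lincomb c v = 0 -> v = 0].
Proof.
have [m [c [cb bc free_c]]] := free_modulo b (submod_closed0 M).
exists m, c; split => // [v|v cv0]; last by apply: free_c; rewrite cv0 inE.
by have [w] := bc v; rewrite inE subr_eq0 => /eqP ?; exists w.
Qed.

Lemma ler_norm_row (R : realType) (m : nat) (v : 'rV[R]_m) (k : 'I_m) :
  `|v ord0 k| <= `|v|.
Proof.
rewrite [leRHS]/Num.norm /= mx_normrE.
by apply/bigmax_geP; right; exists (ord0, k).
Qed.

Section FiniteDim.
Variables (R : realType) (Y : normedModType R).

Lemma finite_dim_basis : finite_dim Y ->
  exists (m : nat) (c : 'I_m -> Y),
    (forall y, exists v, y = lincomb c v) /\ (forall v, lincomb c v = 0 -> v = 0).
Proof.
move=> [n [b bY]]; have [m [c [_ bc free_c]]] := exists_basis b.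
exists m, c; split => // y; have [a ->] := bY y.
have [w bw] := bc (\row_k a k); exists w; rewrite -bw.
by apply: eq_bigr => k _; rewrite mxE.
Qed.

(** A family [c] that is free and spanning modulo [X] gives each [y] a unique row [a y] with
    [y - lincomb c (a y)] in [X]. Uniqueness makes [a] linear, and this difference is the
    projection. *)
Lemma finite_dim_proj (X : {pred Y}) : finite_dim Y -> submod_closed X ->
  exists P : {linear Y -> Y},
    (forall y, P y \in X) /\ {in X, forall x, P x = x}.
Proof.
move=> [n [b bY]] Xsub; have [X0 XD] := Xsub.
have [m [c [_ bc free_c]]] := free_modulo b Xsub.
have /choice[a aX] : forall y, exists v, y - lincomb c v \in X.
  move=> y; have [a ->] := bY y.
  have [w wX] := bc (\row_k a k); exists w.
  by move: wX; congr (_ - _ \in X); apply: eq_bigr => k _; rewrite mxE.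
have XB x y : x \in X -> y \in X -> x - y \in X.
  by move=> xX yX; rewrite addrC -scaleN1r XD.
have a_uniq y v : y - lincomb c v \in X -> a y = v.
  move=> vX; apply/eqP; rewrite -subr_eq0; apply/eqP/free_c.
  rewrite linearB /=.
  have -> : lincomb c (a y) - lincomb c v =
            (y - lincomb c v) - (y - lincomb c (a y)).
    by rewrite opprB [RHS]addrC addrA subrK.
  exact: XB.
have lin_a : linear a.
  move=> t x y; apply: a_uniq; rewrite linearP opprD addrACA -scalerBr.
  exact: XD.
have [P PE] : exists P : {linear Y -> Y}, P =1 fun y => y - lincomb c (a y).
  apply: exists_linear => t x y.
  by rewrite lin_a linearP opprD addrACA -scalerBr.
exists P; split => [y|x xX]; rewrite PE //.
by rewrite (a_uniq x 0) linear0 subr0.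
Qed.

Lemma ler_norm_lincomb (m : nat) (c : 'I_m -> Y) (v : 'rV[R]_m) :
  `|lincomb c v| <= `|v| * \sum_k `|c k|.
Proof.
rewrite (le_trans (ler_norm_sum _ _ _)) // mulr_sumr.
by apply: ler_sum => k _; rewrite normrZ ler_wpM2r // ler_norm_row.
Qed.

(** The norm of the combination is continuous on the compact unit sphere of coefficients, and
    freeness makes its minimum positive. *)
Lemma free_lincomb_bounded_below (m : nat) (c : 'I_m -> Y) :
  (forall v, lincomb c v = 0 -> v = 0) ->
  exists2 C, 0 <= C & forall v, `|v| <= C * `|lincomb c v|.
Proof.
move=> free_c; pose S := [set v : 'rV[R]_m | `|v| = 1].
(* The sphere is empty exactly when [m = 0]; the minimum then does not exist, but the constant [0]
   works. *)
have [S0|/set0P S_neq0] := eqVneq S set0.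
  exists 0 => // v; rewrite mul0r leNgt; apply/negP => v_gt0.
  suff : set0 (`|v|^-1 *: v) by [].
  by rewrite -S0 /S /= normrZ normfV normr_id mulVf // gt_eqF.
have c_cont : continuous (fun v => `|lincomb c v|).
  have lc_cont : continuous (lincomb c).
    apply/linear_bounded_continuous/bounded_funP => r.
    exists (r * \sum_k `|c k|) => x xr.
    by rewrite (le_trans (ler_norm_lincomb _ _)) // ler_wpM2r // sumr_ge0.
  by move=> v; apply: continuous_comp; [exact: lc_cont | exact: norm_continuous].
have S_compact : compact S.
  apply: bounded_closed_compact.
    by exists 1; split => // M M1 v /= ->; exact: ltW.
  rewrite (_ : S = (fun v => `|v|) @^-1` [set 1]) //.
  apply: closed_comp => [v _|]; first exact: norm_continuous.
  exact: closed_eq.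
have [v0 /set_mem v0S v0_min] := EVT_min_rV S_neq0 S_compact
  (continuous_subspaceT c_cont).
have cv0_gt0 : 0 < `|lincomb c v0|.
  rewrite normr_gt0; apply/eqP => /free_c v00.
  by move: v0S; rewrite /S /= v00 normr0 => /eqP; rewrite eq_sym oner_eq0.
exists `|lincomb c v0|^-1; first by rewrite invr_ge0.
move=> v; have [->|v_neq0] := eqVneq v 0; first by rewrite linear0 !normr0 mulr0.
have v_gt0 : 0 < `|v| by rewrite normr_gt0.
have /v0_min : `|v|^-1 *: v \in S.
  by apply/mem_set; rewrite /S /= normrZ normfV normr_id mulVf // gt_eqF.
rewrite linearZ /= normrZ normfV normr_id mulrC ler_pdivlMr //.
by rewrite ler_pdivlMl.
Qed.

Lemma finite_dim_bounded (Z : normedModType R) (f : {linear Y -> Z}) :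
  finite_dim Y -> exists2 C, 0 <= C & forall y, `|f y| <= C * `|y|.
Proof.
move=> /finite_dim_basis[m [c [cY /free_lincomb_bounded_below[C C0 cC]]]].
exists (C * \sum_k `|f (c k)|); first by rewrite mulr_ge0 // sumr_ge0.
move=> y; have [v ->] := cY y; rewrite {1}/lincomb linear_sum.
rewrite (le_trans (ler_norm_sum _ _ _)) // mulrAC mulr_sumr.
apply: ler_sum => k _; rewrite linearZ /= normrZ ler_wpM2r //.
by rewrite (le_trans _ (cC v)) // ler_norm_row.
Qed.

End FiniteDim.

(** * Norms on direct sums *)

(** An alias indexed by [N] and its axioms: the norm is attached to the alias, so it cannot clash
    with another norm on [M]. *)
Definition renormed (R : realType) (M : lmodType R) (N : M -> R)
  (N_D : forall x y, N (x + y) <= N x + N y)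
  (N_Z : forall t x, N (t *: x) = `|t| * N x)
  (N_eq0 : forall x, N x = 0 -> x = 0) : Type := M.

Section Renormed.
Variables (R : realType) (M : lmodType R) (N : M -> R).
Variables (N_D : forall x y, N (x + y) <= N x + N y).
Variables (N_Z : forall t x, N (t *: x) = `|t| * N x).
Variables (N_eq0 : forall x, N x = 0 -> x = 0).

HB.instance Definition _ := GRing.Lmodule.copy (renormed N_D N_Z N_eq0) M.
HB.instance Definition _ :=
  Lmodule_isNormed.Build R (renormed N_D N_Z N_eq0) N_D N_Z N_eq0.

End Renormed.

(** The norm is pulled back to the coefficients of a basis of the span. Definiteness is asked on the
    span only, since the pushout seminorm vanishes at every pair [(a k, - b k)]. *)
Lemma normed_span (R : realType) (M : lmodType R) (n : nat) (b : 'I_n -> M)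
    (N : M -> R) :
  (forall x y, N (x + y) <= N x + N y) ->
  (forall t x, N (t *: x) = `|t| * N x) ->
  (forall v, N (lincomb b v) = 0 -> lincomb b v = 0) ->
  exists (Y : normedModType R) (f : {linear Y -> M}),
    [/\ finite_dim Y, forall y, `|y| = N (f y) &
        forall v, exists y, f y = lincomb b v].
Proof.
move=> N_D N_Z N_eq0; have [m [c [cb bc free_c]]] := exists_basis b.
pose L v := N (lincomb c v).
have L_D u v : L (u + v) <= L u + L v by rewrite /L linearD.
have L_Z t v : L (t *: v) = `|t| * L v by rewrite /L linearZ N_Z.
have L_eq0 v : L v = 0 -> v = 0.
  move=> Lv0; apply: free_c; have [w cw] := lincomb_comp v cb.
  by rewrite cw; apply: N_eq0; rewrite -cw.
pose Y : normedModType R := renormed L_D L_Z L_eq0.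
have [f fE] : exists f : {linear Y -> M}, f =1 lincomb c.
  exact: (@exists_linear R Y M (lincomb c) (linearP (lincomb c))).
exists Y, f; split.
- exists m, (fun k => delta_mx ord0 k : Y) => v; exists (v ord0).
  exact: row_sum_delta.
- by move=> y; rewrite fE.
- by move=> v; have [w ->] := bc v; exists w; rewrite fE.
Qed.

Section PushNorm.
Variables (R : realType) (E F : normedModType R) (K : lmodType R).
Variables (a : {linear K -> E}) (b : {linear K -> F}) (eps : R).
Hypothesis eps_ge0 : 0 <= eps.

(* With [eps = 0] this is the quotient seminorm of the pushout of [a] and [b]; with
   [eps > 0] it makes [(a k, 0)] and [(0, b k)] only [eps * `|a k|]-close. *)
Definition pushcost (p : E * F) (k : K) : R :=
  `|p.1 - a k| + `|p.2 + b k| + eps * `|a k|.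

Definition pushnorm (p : E * F) : R := inf (range (pushcost p)).

Lemma pushcost_ge0 p k : 0 <= pushcost p k.
Proof. by rewrite !addr_ge0 // mulr_ge0. Qed.

Lemma pushnorm_le p k : pushnorm p <= pushcost p k.
Proof.
apply: ge_inf; last by exists k.
by exists 0 => _ [l _ <-]; exact: pushcost_ge0.
Qed.

Lemma le_pushnorm p t : (forall k, t <= pushcost p k) -> t <= pushnorm p.
Proof.
move=> tp; apply: lb_le_inf; first by exists (pushcost p 0); exists 0.
by move=> _ [k _ <-].
Qed.

Lemma pushnorm_ge0 p : 0 <= pushnorm p.
Proof. by apply: le_pushnorm => k; exact: pushcost_ge0. Qed.

Lemma pushnormD p q : pushnorm (p + q) <= pushnorm p + pushnorm q.
Proof.
rewrite -lerBlDr; apply: le_pushnorm => k.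
rewrite lerBlDl -lerBlDr; apply: le_pushnorm => l; rewrite lerBlDr.
rewrite (le_trans (pushnorm_le _ (l + k))) // /pushcost !linearD /=.
rewrite [p.1 + _]addrC [p.2 + _]addrC (addrACA q.1) (addrACA q.2).
have := ler_normD (q.1 - a l) (p.1 - a k).
have := ler_normD (q.2 + b l) (p.2 + b k).
have := ler_wpM2l eps_ge0 (ler_normD (a l) (a k)).
by rewrite mulrDr; lra.
Qed.

Lemma pushnormZ t p : pushnorm (t *: p) = `|t| * pushnorm p.
Proof.
have le_Z s q : pushnorm (s *: q) <= `|s| * pushnorm q.
  have costZ k : pushnorm (s *: q) <= `|s| * pushcost q k.
    rewrite (le_trans (pushnorm_le _ (s *: k))) // /pushcost !linearZ /=.
    by rewrite -!scalerDr !normrZ !mulrDr mulrCA.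
  have [->|s_neq0] := eqVneq s 0.
    by rewrite (le_trans (pushnorm_le _ 0)) // /pushcost !linear0 /= scale0r;
      rewrite ?(scale0r, subr0, addr0, normr0, mulr0, mul0r).
  rewrite -ler_pdivrMl ?normr_gt0 //; apply: le_pushnorm => k.
  by rewrite ler_pdivrMl ?normr_gt0.
apply/eqP; rewrite eq_le le_Z /=.
have [->|t_neq0] := eqVneq t 0; first by rewrite normr0 mul0r pushnorm_ge0.
rewrite -ler_pdivlMl ?normr_gt0 // -normfV -{1}[p](scalerK t_neq0).
exact: le_Z.
Qed.

Lemma pushnorm_le_norm p : pushnorm p <= `|p.1| + `|p.2|.
Proof.
rewrite (le_trans (pushnorm_le p 0)) // /pushcost !linear0 normr0 mulr0.
by rewrite !addr0.
Qed.

(** In the cost at [k] the terms [|a k| + eps * |a k|] dominate [|b k|], so the triangle inequality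
    leaves at least [|y|]; [k = 0] attains it. *)
Lemma pushnorm_inr y : (forall k, `|b k| <= (1 + eps) * `|a k|) ->
  pushnorm (0, y) = `|y|.
Proof.
move=> ba; apply/eqP; rewrite eq_le.
rewrite (le_trans (pushnorm_le_norm _)) ?normr0 ?add0r //=.
apply: le_pushnorm => k; rewrite /pushcost /= sub0r normrN.
have := ler_normB (y + b k) (b k); rewrite addrK; have := ba k; lra.
Qed.

Lemma pushnorm_inl x : (forall k, `|a k| <= (1 + eps) * `|b k|) ->
  pushnorm (x, 0) = `|x|.
Proof.
move=> ab; apply/eqP; rewrite eq_le.
rewrite (le_trans (pushnorm_le_norm _)) ?normr0 ?addr0 //=.
apply: le_pushnorm => k; rewrite /pushcost /= add0r.
have key : `|a k| <= `|b k| + eps * `|a k|.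
  have [ba|/ltW ab'] := leP `|b k| `|a k|; last first.
    by rewrite (le_trans ab') // lerDl mulr_ge0.
  rewrite (le_trans (ab k)) // mulrDl mul1r lerD2l.
  exact: ler_wpM2l.
have := ler_normD (x - a k) (a k); rewrite subrK; lra.
Qed.

(** The last bound gives [|x| <= C * pushnorm (x, y)], so [x = 0], and [pushnorm_inr] then handles
    [y]. *)
Lemma pushnorm_eq0 (C : R) (x : E) (y : F) : 0 < C ->
  (forall k, `|b k| <= (1 + eps) * `|a k|) ->
  (forall k, `|x| <= C * (`|x - a k| + eps * `|a k|)) ->
  pushnorm (x, y) = 0 -> (x, y) = 0.
Proof.
move=> C_gt0 ba xC xy0.
have : `|x| <= C * pushnorm (x, y).
  rewrite -ler_pdivrMl //; apply: le_pushnorm => k; rewrite ler_pdivrMl //.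
  apply: le_trans (xC k) _; apply: ler_wpM2l; first exact: ltW.
  by rewrite /pushcost /= lerD2r lerDl.
rewrite xy0 mulr0 normr_le0 => /eqP x0; move: xy0; rewrite x0 pushnorm_inr //.
by move=> /normr0_eq0 ->.
Qed.

End PushNorm.

(** * Almost isometric finite sequences *)

Lemma linear_lincomb (K : pzRingType) (M N : lmodType K) (f : {linear M -> N})
    (m : nat) (c : 'I_m -> M) (v : 'rV[K]_m) :
  f (lincomb c v) = lincomb (f \o c) v.
Proof. by rewrite /lincomb linear_sum; apply: eq_bigr => k _; rewrite linearZ. Qed.

(** Sending [x k] to [y k] for [k < n] is then a well-defined almost isometry of the spans. Total
    sequences let [n] grow without a change of type. *)
Definition almost_isometric (R : realType) (E F : normedModType R) (n : nat)
    (eps : R) (x : nat -> E) (y : nat -> F) : Prop :=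
  forall v : 'rV[R]_n,
    `|lincomb (fun k : 'I_n => x k) v| <=
      (1 + eps) * `|lincomb (fun k : 'I_n => y k) v| /\
    `|lincomb (fun k : 'I_n => y k) v| <=
      (1 + eps) * `|lincomb (fun k : 'I_n => x k) v|.

Lemma almost_isometricC (R : realType) (E F : normedModType R) (n : nat)
    (eps : R) (x : nat -> E) (y : nat -> F) :
  almost_isometric n eps x y -> almost_isometric n eps y x.
Proof. by move=> xy v; have [] := xy v. Qed.

(* The norm [pushnorm] puts the two spans into one finite-dimensional space in
   which [x k] and [y k] are [eps * `|x k|]-close; extending the embedding of the
   span of the [y k] to that space and restricting it to the span of the [x k]
   gives the new family. *)
Lemma almost_isometric_step (R : realType) (E : normedModType R)
    (F : completeNormedModType R) (n : nat) (eps delta : R) (x : nat -> E)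
    (y : nat -> F) :
  gurarii_space F -> almost_isometric n eps x y ->
  0 < eps -> 0 < delta -> delta <= 1 ->
  exists y' : nat -> F, almost_isometric n.+1 delta x y' /\
    forall k, (k < n)%N -> `|y' k - y k| <= 2 * eps * `|x k|.
Proof.
move=> [_ gurF] xy eps_gt0 delta_gt0 delta_le1; have eps_ge0 := ltW eps_gt0.
pose a : {linear 'rV[R]_n -> E} := lincomb (fun k : 'I_n => x k).
pose b : {linear 'rV[R]_n -> F} := lincomb (fun k : 'I_n => y k).
have ab v : `|a v| <= (1 + eps) * `|b v| by have [] := xy v.
have ba v : `|b v| <= (1 + eps) * `|a v| by have [] := xy v.
pose N := pushnorm a b eps.
have [il ilE] : exists il : {linear E -> (E * F)%type}, il =1 fun u => (u, 0).
  by apply: exists_linear => t u w; rewrite -[RHS]/(_, _) /= scaler0 addr0.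
(* The left side has one vector more: [x n] is new and has no partner yet. *)
pose fam (k : 'I_(n.+1 + n)) : E * F :=
  match fintype.split k with inl i => (x i, 0) | inr i => (0, y i) end.
have N_eq0 v : N (lincomb fam v) = 0 -> lincomb fam v = 0.
  case: (lincomb fam v) => u w.
  (* The summand [eps^-1] recovers [|a k|] from the penalty [eps * |a k|]. *)
  apply: (@pushnorm_eq0 _ _ _ _ _ _ _ eps_ge0 (1 + eps^-1)) => // [|k].
    by rewrite addr_gt0 ?invr_gt0.
  have := ler_normD (u - a k) (a k); rewrite subrK => /le_trans; apply.
  rewrite mulrDl mul1r mulrDr mulrA mulVf ?gt_eqF // mul1r.
  have : 0 <= eps^-1 * `|u - a k| by rewrite mulr_ge0 ?invr_ge0.
  have : 0 <= eps * `|a k| by rewrite mulr_ge0.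
  lra.
have [Y [f [Yfin Ynorm fY]]] := normed_span (pushnormD _ _ eps_ge0)
  (pushnormZ _ _ eps_ge0) N_eq0.
have /choice[s fs] : forall k : 'I_n.+1, exists z, f z = (x k, 0).
  move=> k; have [z fz] := fY (delta_mx ord0 (lshift n k)); exists z.
  by rewrite fz lincomb_delta /fam (unsplitK (inl k)).
have /choice[t ft] : forall k : 'I_n, exists z, f z = (0, y k).
  move=> k; have [z fz] := fY (delta_mx ord0 (rshift n.+1 k)); exists z.
  by rewrite fz lincomb_delta /fam (unsplitK (inr k)).
pose X := [pred z | (f z).1 == 0].
have X_sub : submod_closed X.
  split=> [|c u w]; first by rewrite inE linear0.
  by rewrite !inE linearP /= => /eqP -> /eqP ->; rewrite scaler0 addr0.
have i_isom : isometric_embedding_on X (fun z => (f z).2).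
  split=> [c u w _ _|z]; first by rewrite linearP.
  rewrite inE => /eqP fz0; rewrite Ynorm; case: (f z) fz0 => _ w /= ->.
  by rewrite pushnorm_inr.
have [j [jX j_bd]] := gurF Y X delta _ Yfin X_sub delta_gt0 i_isom.
exists (fun k => j (s (inord k))); split=> [v|k kn].
  have -> : lincomb (fun k : 'I_n.+1 => j (s (inord k))) v = j (lincomb s v).
    rewrite linear_lincomb; congr lincomb; apply/funext => k /=.
    by rewrite inord_val.
  have -> : `|lincomb (fun k : 'I_n.+1 => x k) v| = `|lincomb s v|.
    rewrite Ynorm linear_lincomb (_ : f \o s = il \o (fun k : 'I_n.+1 => x k)).
      by rewrite -linear_lincomb ilE pushnorm_inl.
    by apply/funext => k; rewrite /= ilE fs.
  have /andP[lo hi] := j_bd (lincomb s v); split => //.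
  by rewrite -ler_pdivrMl // addr_gt0.
have xkE : f (s (inord k)) = (x k, 0) by rewrite fs inordK // ltnW.
have tkX : t (Ordinal kn) \in X by rewrite inE ft.
have -> : y k = j (t (Ordinal kn)) by rewrite jX // ft.
(* The factor [2] bounds [1 + delta]. At the [k]-th unit vector the cost of [(x k, - y k)] reduces
   to the penalty [eps * |x k|]. *)
rewrite -linearB; have /andP[_ /le_trans->] // := j_bd (s (inord k) - t (Ordinal kn)).
rewrite -mulrA; apply: ler_pM => //; first by rewrite addr_ge0 // ltW.
  by rewrite -natr1 [leRHS]addrC lerD2l.
rewrite Ynorm linearB xkE ft.
have aE : a (delta_mx ord0 (Ordinal kn)) = x k by exact: lincomb_delta.
have bE : b (delta_mx ord0 (Ordinal kn)) = y k by exact: lincomb_delta.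
have := @pushnorm_le _ _ _ _ a b _ eps_ge0 ((x k, 0) - (0, y k))
  (delta_mx ord0 (Ordinal kn)).
by rewrite /pushcost aE bE /= subr0 sub0r subrr addNr !normr0 !add0r.
Qed.

(** * Limits and dense sequences *)

(** Approximants are needed at arbitrarily late indices, where the errors of the back-and-forth are
    small, so each point of the dense set must recur infinitely often. *)
Lemma separable_seq (R : realType) (E : normedModType R) : separable E ->
  exists d : nat -> E, forall e eta M, 0 < eta ->
    exists2 m, (M <= m)%N & `|e - d m| < eta.
Proof.
move=> [D /countable_injP[f f_inj] D_dense].
have /choice[d dE] : forall n : nat, exists a : E, forall b, D b -> f b = n -> b = a.
  move=> n; have [[a [Da fa]]|noa] := pselect (exists a, D a /\ f a = n).
    exists a => b Db fb; apply: f_inj; rewrite ?inE //; congruence.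
  by exists 0 => b Db fb; case: noa; exists b.
(* The exponent of [2] in [m.+1] takes every value infinitely often, namely at [2 ^ n] times any odd
   number. *)
exists (fun m => d (logn 2 m.+1)) => e eta M eta_gt0.
have [] := D_dense (ball e eta).
- by exists e; exact: ballxx.
- exact: ball_open.
move=> a [ea Da]; exists (2 ^ f a * M.*2.+1).-1%N.
  rewrite -ltnS prednK ?muln_gt0 ?expn_gt0 //.
  by rewrite (leq_trans _ (leq_pmull _ _)) ?expn_gt0 // ltnS -addnn leq_addr.
rewrite prednK ?muln_gt0 ?expn_gt0 // lognM ?expn_gt0 // pfactorK //.
rewrite [logn 2 M.*2.+1]logn_coprime ?addn0; last first.
  by rewrite coprime2n /= odd_double.
by rewrite -(dE _ _ Da erefl); move: ea; rewrite -ball_normE.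
Qed.

Lemma expr_half_lt (R : realType) (eta : R) : 0 < eta ->
  exists M, forall m, (M <= m)%N -> 2^-1 ^+ m < eta.
Proof.
move=> eta_gt0.
have /cvgrPdist_lt/(_ eta eta_gt0)[M _ HM] : (fun m => (2^-1 : R) ^+ m) @ \oo --> 0.
  by apply: cvg_expr; rewrite ger0_norm ?invr_ge0 // invf_lt1 // ltr1n.
exists M => m /HM /=; rewrite sub0r normrN ger0_norm //.
Qed.

Lemma geometric_cvg (R : realType) (V : completeNormedModType R) (u : nat -> V)
    (M : nat) : (forall m, (M <= m)%N -> `|u m.+1 - u m| <= 2^-1 ^+ m) ->
  exists2 l, u @ \oo --> l & forall m, (M <= m)%N -> `|l - u m| <= 2 * 2^-1 ^+ m.
Proof.
move=> uM.
have u_dist m p : (M <= m)%N -> `|u (m + p)%N - u m| <= 2 * 2^-1 ^+ m.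
  move=> Mm; have h_ge0 q : 0 <= 2^-1 ^+ q :> R by rewrite exprn_ge0 // invr_ge0.
  (* The exact geometric sum is what the induction on [p] can carry. *)
  suff : `|u (m + p)%N - u m| <= 2 * (2^-1 ^+ m - 2^-1 ^+ (m + p)).
    by move/le_trans; apply; rewrite ler_wpM2l // gerBl.
  elim: p => [|p IH]; first by rewrite addn0 !subrr normr0 mulr0.
  have := uM (m + p)%N (leq_trans Mm (leq_addr _ _)).
  have := ler_normD (u (m + p.+1)%N - u (m + p)%N) (u (m + p)%N - u m).
  by rewrite subrKA addnS exprS; move: IH; lra.
have u_cvg : cvg (u @ \oo).
  apply/cauchy_cvgP/cauchy_exP => eta eta_gt0.
  have [|N HN] := @expr_half_lt R (eta / 2); first by rewrite divr_gt0.
  pose m := maxn M N; exists (u m); exists m => // p /= mp.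
  rewrite -ball_normE /= distrC -(subnKC mp).
  rewrite (le_lt_trans (u_dist _ _ (leq_maxl _ _))) //.
  by rewrite mulrC -ltr_pdivlMr // HN // leq_maxr.
exists (lim (u @ \oo)) => // m Mm.
have : (fun p => `|u p - u m|) @ \oo --> `|lim (u @ \oo) - u m|.
  by apply: cvg_norm; apply: cvgB => //; exact: cvg_cst.
move=> /cvgr_to_le; apply; exists m => // p /= mp.
by rewrite -(subnKC mp) u_dist.
Qed.


(** The three-term identity carries everything: [t = 0] gives equal distances, [t = -1] with equal
    indices gives equal norms, and general [t] gives linearity of the limit map. *)
Lemma isometry_of_dense (R : realType) (E F : completeNormedModType R)
    (x : nat -> E) (y : nat -> F) :
  (forall e eta, 0 < eta -> exists k, `|e - x k| < eta) ->
  (forall e eta, 0 < eta -> exists k, `|e - y k| < eta) ->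
  (forall t k l m, `|x m - (t *: x k + x l)| = `|y m - (t *: y k + y l)|) ->
  linearly_isometric E F.
Proof.
move=> x_dense y_dense xy.
have dist_xy k l : `|x k - x l| = `|y k - y l|.
  by have := xy 0 0%N l k; rewrite !scale0r !add0r.
(* The image of [e] is characterised by its distances to all [y' k]. Stated for arbitrary spaces,
   this serves for the map and for its inverse. *)
have extend (E' F' : completeNormedModType R) (x' : nat -> E') (y' : nat -> F') :
    (forall e eta, 0 < eta -> exists k, `|e - x' k| < eta) ->
    (forall k l, `|x' k - x' l| = `|y' k - y' l|) ->
    forall e, exists f, forall k, `|e - x' k| = `|f - y' k|.
  move=> x'_dense dist_xy' e.
  have h_gt0 j : 0 < 2^-1 ^+ j.+2 :> R by rewrite exprn_gt0 // invr_gt0.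
  have /choice[s sE] : forall j, exists k, `|e - x' k| < 2^-1 ^+ j.+2.
    by move=> j; exact: x'_dense.
  have [|f y's _] := @geometric_cvg R F' (y' \o s) 0%N.
    move=> j _; rewrite /= -dist_xy'.
    have := ler_normB (e - x' (s j)) (e - x' (s j.+1)).
    rewrite opprB addrC subrKA.
    have := sE j; have := sE j.+1; have := h_gt0 j; rewrite !exprS; lra.
  have x's : x' \o s @ \oo --> e.
    apply/cvgrPdist_lt => eta /expr_half_lt[M HM]; exists M => // j /= Mj.
    rewrite (lt_trans (sE j)) // HM // (leq_trans Mj) //.
    by rewrite -addn2 leq_addr.
  exists f => k.
  have c1 : (fun j => `|x' (s j) - x' k|) @ \oo --> `|e - x' k|.
    by apply: cvg_norm; apply: cvgB; [exact: x's | exact: cvg_cst].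
  have c2 : (fun j => `|x' (s j) - x' k|) @ \oo --> `|f - y' k|.
    under eq_fun do rewrite dist_xy'.
    by apply: cvg_norm; apply: cvgB; [exact: y's | exact: cvg_cst].
  exact: (cvg_unique _ c1 c2).
have [phi phiE] := choice (extend _ _ _ _ x_dense dist_xy).
have [psi psiE] := choice (extend _ _ _ _ y_dense (fun k l => esym (dist_xy k l))).
have uniq (V : completeNormedModType R) (z : nat -> V) (u w : V) :
    (forall e eta, 0 < eta -> exists k, `|e - z k| < eta) ->
    (forall k, `|u - z k| = `|w - z k|) -> u = w.
  move=> z_dense uw; apply/eqP; rewrite -subr_eq0 -normr_le0.
  apply/ler_addgt0Pl => eta eta_gt0; rewrite addr0.
  have [|k uk] := z_dense u (eta / 2); first by rewrite divr_gt0.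
  have := ler_normB (u - z k) (w - z k); rewrite -(uw k) opprB addrA subrK.
  by lra.
have phi_lin : linear phi.
  move=> t u w; apply/eqP; rewrite -subr_eq0 -normr_le0.
  apply/ler_addgt0Pl => eta eta_gt0; rewrite addr0.
  (* The three approximation errors, one of them scaled by [|t|], are each paid twice: once in [E]
     and once in [F]. *)
  pose eta' := eta / (4 * (1 + `|t|)).
  have T_gt0 : 0 < 1 + `|t| by rewrite ltr_pwDl.
  have eta'_gt0 : 0 < eta' by rewrite divr_gt0 // mulr_gt0.
  have etaE : eta = 4 * eta' + 4 * (`|t| * eta').
    by rewrite /eta'; field; rewrite gt_eqF.
  have [k ku] := x_dense u _ eta'_gt0.
  have [l lw] := x_dense w _ eta'_gt0.
  have [m mz] := x_dense (t *: u + w) _ eta'_gt0.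
  have tku : `|t| * `|u - x k| <= `|t| * eta' by rewrite ler_wpM2l // ltW.
  have dist3 (V : completeNormedModType R) (z z1 z2 a a1 a2 : V) :
      `|z - (t *: z1 + z2)| <=
      `|z - a| + `|t| * `|z1 - a1| + `|z2 - a2| + `|a - (t *: a1 + a2)|.
    have -> : z - (t *: z1 + z2) =
        (z - a) - t *: (z1 - a1) - (z2 - a2) + (a - (t *: a1 + a2)).
      rewrite scalerBr !opprD !opprK (addrACA z) (addrACA (z - _)) -[RHS]addrA.
      rewrite -[- a + _ + _]addrA (addrACA (- a)) addNr add0r.
      by rewrite -(opprD (t *: a1)) subrr addr0 addrA.
    rewrite -normrZ (le_trans (ler_normD _ _)) // lerD2r.
    rewrite (le_trans (ler_normB _ _)) // lerD2r.
    by rewrite (le_trans (ler_normB _ _)).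
  have dF := dist3 _ (phi (t *: u + w)) (phi u) (phi w) (y m) (y k) (y l).
  have dE := dist3 _ (x m) (x k) (x l) (t *: u + w) u w.
  rewrite -!phiE -xy in dF.
  rewrite subrr normr0 (distrC (x m) (t *: u + w)) in dE.
  rewrite (distrC (x k)) (distrC (x l)) in dE.
  have : 0 <= `|t| * eta' by rewrite mulr_ge0 // ltW.
  move: mz lw; lra.
have [f fE] := exists_linear phi_lin.
exists f; split.
  exists psi => e.
    by apply: (uniq _ _ _ _ x_dense) => k; rewrite fE -psiE -phiE.
  by apply: (uniq _ _ _ _ y_dense) => k; rewrite fE -phiE -psiE.
move=> e; rewrite fE.
have norm_xy k : `|x k| = `|y k|.
  by have := xy (-1) k k k; rewrite !scaleN1r !addNr !subr0.
have close eta : 0 < eta -> `|e| <= eta + `|phi e| /\ `|phi e| <= eta + `|e|.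
  move=> eta_gt0; have [|k ke] := x_dense e (eta / 2); first by rewrite divr_gt0.
  have := ler_normD (e - x k) (x k); have := ler_normD (phi e - y k) (y k).
  have := ler_normB (phi e) (phi e - y k); have := ler_normB e (e - x k).
  rewrite !subKr !subrK -norm_xy -phiE; lra.
by apply/eqP; rewrite eq_le; apply/andP; split; apply/ler_addgt0Pl => eta /close[].
Qed.

(** * Uniqueness of the Gurarii space *)

Section BackAndForth.
Variable R : realType.

(* By [almost_isometric_step], the last clause bounds by [t] the perturbation
   made when either sequence is extended next. *)
Definition close_match (E F : normedModType R) (n : nat) (t : R) (x : nat -> E)
    (y : nat -> F) : Prop :=
  exists eps, [/\ 0 < eps, eps <= t, almost_isometric n eps x y &
    forall k, (k < n)%N -> 2 * eps * `|x k| <= t /\ 2 * eps * `|y k| <= t].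

Lemma close_matchC (E F : normedModType R) (n : nat) (t : R) (x : nat -> E)
    (y : nat -> F) : close_match n t x y -> close_match n t y x.
Proof.
move=> [eps [eps_gt0 eps_t xy bnd]]; exists eps; split=> // [|k /bnd[]//].
exact: almost_isometricC.
Qed.

Lemma close_match_step (E : normedModType R) (F : completeNormedModType R)
    (n : nat) (t t' : R) (x : nat -> E) (y : nat -> F) (e : E) :
  gurarii_space F -> 0 < t' -> t' <= 1 -> close_match n t x y ->
  exists (x' : nat -> E) (y' : nat -> F),
    [/\ close_match n.+1 t' x' y', x' n = e,
        forall k, (k < n)%N -> x' k = x k &
        forall k, (k < n)%N -> `|y' k - y k| <= t].
Proof.
move=> gurF t'_gt0 t'_le1 [eps [eps_gt0 eps_t xy bnd]].
pose x' k := if (k < n)%N then x k else e.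
have x'x k : (k < n)%N -> x' k = x k by rewrite /x' => ->.
pose S : R := 1 + \sum_(k < n.+1) `|x' k|.
have S_ge1 : 1 <= S by rewrite lerDl sumr_ge0.
have S_gt0 : 0 < S by rewrite (lt_le_trans ltr01).
have x'S k : (k < n.+1)%N -> `|x' k| <= S.
  move=> kn; rewrite /S (bigD1 (Ordinal kn)) //= addrCA lerDl addr_ge0 //.
  by rewrite sumr_ge0.
(* [S] involves only [x'], since [y'] is chosen after [delta]. From [delta <= 1] follows
   [|y' k| <= 2 * |x' k|], hence the [4]; [S >= 1] gives [delta <= t']. *)
pose delta := t' / (4 * S).
have delta_gt0 : 0 < delta by rewrite divr_gt0 // mulr_gt0.
have deltaE : 4 * (delta * S) = t' by rewrite /delta; field; rewrite gt_eqF.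
have delta_t' : delta <= t'.
  by have : delta * 1 <= delta * S by [rewrite ler_wpM2l // ltW]; lra.
have delta_le1 := le_trans delta_t' t'_le1.
have x'y : almost_isometric n eps x' y.
  move=> v; have := xy v.
  suff -> : (fun k : 'I_n => x' k) = (fun k : 'I_n => x k) by [].
  by apply/funext => k; rewrite x'x.
have [y' [x'y' y'y]] :=
  almost_isometric_step gurF x'y eps_gt0 delta_gt0 delta_le1.
exists x', y'; split => //; [|by rewrite /x' ltnn|]; last first.
  move=> k kn; rewrite (le_trans (y'y k kn)) // x'x //.
  by have [] := bnd k kn.
exists delta; split => // k kn.
have dx : delta * `|x' k| <= delta * S by rewrite ler_wpM2l ?x'S // ltW.
have dx_ge0 : 0 <= delta * `|x' k| by rewrite mulr_ge0 // ltW.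
have y'k : `|y' k| <= (1 + delta) * `|x' k|.
  have [_] := x'y' (delta_mx ord0 (Ordinal kn)).
  by rewrite !lincomb_delta.
have dy : delta * `|y' k| <= 2 * (delta * `|x' k|).
  rewrite mulrCA ler_wpM2l ?(ltW delta_gt0) // (le_trans y'k) // ler_wpM2r //.
  by lra.
by rewrite -!(mulrA 2); split; lra.
Qed.

Lemma close_match_three (E F : normedModType R) (n : nat) (t c : R)
    (x : nat -> E) (y : nat -> F) (k l m : nat) :
  close_match n t x y -> (k < n)%N -> (l < n)%N -> (m < n)%N ->
  `|x m - (c *: x k + x l)| <= (1 + t) * `|y m - (c *: y k + y l)|.
Proof.
move=> [eps [_ eps_t xy _]] kn ln mn.
pose v : 'rV[R]_n := delta_mx ord0 (Ordinal mn) -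
  (c *: delta_mx ord0 (Ordinal kn) + delta_mx ord0 (Ordinal ln)).
have vE (V : normedModType R) (z : nat -> V) :
    lincomb (fun i : 'I_n => z i) v = z m - (c *: z k + z l).
  by rewrite linearB linearP /= !lincomb_delta.
have [] := xy v; rewrite !vE => /le_trans xle _; apply: xle.
by rewrite ler_wpM2r // lerD2l.
Qed.

Lemma le_of_cvg_slack (A B h : nat -> R) (a b : R) :
  A @ \oo --> a -> B @ \oo --> b -> h @ \oo --> 0 ->
  (\forall n \near \oo, A n <= (1 + h n) * B n) -> a <= b.
Proof.
move=> Aa Bb h0; apply: ler_cvg_to Aa _.
have -> : b = (1 + 0) * b by rewrite addr0 mul1r.
by apply: cvgM => //; apply: cvgD => //; exact: cvg_cst.
Qed.

Lemma gurarii_unique (E F : completeNormedModType R) :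
  gurarii_space E -> gurarii_space F -> linearly_isometric E F.
Proof.
move=> gurE gurF.
have [d d_dense] := separable_seq gurE.1; have [f f_dense] := separable_seq gurF.1.
pose h m : R := 2^-1 ^+ m.
have h_gt0 m : 0 < h m by rewrite exprn_gt0 // invr_gt0.
have h_le1 m : h m <= 1 by rewrite exprn_ile1 ?invr_ge0 // invf_le1 // ler1n.
have hS m : h m = 2 * h m.+1 by rewrite /h exprS mulrA mulfV ?mul1r.
pose good m (s : (nat -> E) * (nat -> F)) := close_match m.*2 (h m) s.1 s.2.
(* A stage makes two half-steps: index [m.*2] receives [d m] on the left, then [m.*2.+1] receives
   [f m] on the right. The second one perturbs the left terms again, so [d m] is met only
   approximately. *)
pose refines m (s s' : (nat -> E) * (nat -> F)) :=
  [/\ forall k, (k < m.*2)%N -> `|s'.1 k - s.1 k| <= h m,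
      forall k, (k < m.*2)%N -> `|s'.2 k - s.2 k| <= h m,
      `|d m - s'.1 m.*2| <= h m & s'.2 m.*2.+1 = f m].
have step m s : exists s', good m s -> good m.+1 s' /\ refines m s s'.
  (* Pairs that are not good get an arbitrary successor, which makes the step total for [choice]. *)
  have [gs|] := pselect (good m s); last by exists s.
  have [x1 [y1 [m1 x1d x1x y1y]]] :=
    close_match_step (d m) gurF (h_gt0 m.+1) (h_le1 m.+1) gs.
  have [y2 [x2 [m2 y2f y2y x2x]]] :=
    close_match_step (f m) gurE (h_gt0 m.+1) (h_le1 m.+1) (close_matchC m1).
  exists (x2, y2) => _; split; first exact: close_matchC.
  have hm := hS m; have hm1 := h_gt0 m.+1.
  split => //= [k kn|k kn|].
  - by rewrite -x1x // (le_trans (x2x _ _)) ?(leq_trans kn) //; lra.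
  - by rewrite y2y ?y1y // ltnW.
  - by rewrite -x1d distrC (le_trans (x2x _ _)) //; lra.
have [nxt nxtE] := choice (fun ms => step ms.1 ms.2).
pose fix s m := if m is m'.+1 then nxt (m', s m') else ((fun=> 0), (fun=> 0)).
have s_good m : good m (s m).
  elim: m => [|m IH]; last by have [] := nxtE (m, s m) IH.
  by exists 1; split => // v; rewrite /lincomb !big_ord0 !normr0 mulr0.
have s_ref m : refines m (s m) (s m.+1) by have [] := nxtE (m, s m) (s_good m).
have /choice[x xE] : forall k, exists l,
    (fun m => (s m).1 k) @ \oo --> l /\
    forall m, (k < m.*2)%N -> `|l - (s m).1 k| <= 2 * h m.
  (* [k./2.+1] is the first stage [m] with [k < m.*2]; from there on the [k]-th term moves by at
     most [h m]. *)
  move=> k; have [|l sl lE] := @geometric_cvg R E (fun m => (s m).1 k) k./2.+1.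
    by move=> m; rewrite ltn_half_double => km; have [+ _ _ _] := s_ref m; apply.
  by exists l; split=> // m; rewrite -ltn_half_double; exact: lE.
have /choice[y yE] : forall k, exists l,
    (fun m => (s m).2 k) @ \oo --> l /\
    forall m, (k < m.*2)%N -> `|l - (s m).2 k| <= 2 * h m.
  move=> k; have [|l sl lE] := @geometric_cvg R F (fun m => (s m).2 k) k./2.+1.
    by move=> m; rewrite ltn_half_double => km; have [_ + _ _] := s_ref m; apply.
  by exists l; split=> // m; rewrite -ltn_half_double; exact: lE.
apply: (@isometry_of_dense R E F x y).
- move=> e eta eta_gt0.
  have [|M HM] := @expr_half_lt R (eta / 4); first by rewrite divr_gt0.
  have [|m Mm dm] := d_dense e (eta / 4) M; first by rewrite divr_gt0.
  exists m.*2; have [_ _ sd _] := s_ref m.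
  have [_ /(_ m.+1)] := xE m.*2.
  rewrite doubleS ltnS leqnSn => /(_ isT) xs.
  have := HM m Mm; rewrite -/(h m) => hm.
  have := ler_normD (e - d m) (d m - (s m.+1).1 m.*2).
  have := ler_normB (e - (s m.+1).1 m.*2) (x m.*2 - (s m.+1).1 m.*2).
  have := hS m.
  rewrite subrKA opprB addrA subrK; lra.
- move=> e eta eta_gt0.
  have [|M HM] := @expr_half_lt R (eta / 4); first by rewrite divr_gt0.
  have [|m Mm dm] := f_dense e (eta / 4) M; first by rewrite divr_gt0.
  exists m.*2.+1; have [_ _ _ sf] := s_ref m.
  have [_ /(_ m.+1)] := yE m.*2.+1.
  rewrite doubleS leqnn => /(_ isT); rewrite sf => ys.
  have := HM m Mm; rewrite -/(h m) => hm.
  have := ler_normB (e - f m) (y m.*2.+1 - f m).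
  have := hS m.
  rewrite opprB addrA subrK; lra.
move=> t k l m.
have h0 : h @ \oo --> 0.
  apply/cvgrPdist_lt => eta /expr_half_lt[M HM]; exists M => // n /HM.
  by rewrite sub0r normrN ger0_norm // ltW.
have xc : (fun n => `|(s n).1 m - (t *: (s n).1 k + (s n).1 l)|) @ \oo -->
    `|x m - (t *: x k + x l)|.
  apply: cvg_norm; apply: cvgB; first exact: (xE m).1.
  by apply: cvgD; [apply: cvgZr; exact: (xE k).1 | exact: (xE l).1].
have yc : (fun n => `|(s n).2 m - (t *: (s n).2 k + (s n).2 l)|) @ \oo -->
    `|y m - (t *: y k + y l)|.
  apply: cvg_norm; apply: cvgB; first exact: (yE m).1.
  by apply: cvgD; [apply: cvgZr; exact: (yE k).1 | exact: (yE l).1].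
have big n i : (i <= k + l + m -> k + l + m < n -> i < n.*2)%N.
  by move=> ib bn; rewrite -addnn (leq_ltn_trans ib) // (leq_trans bn) // leq_addr.
apply/eqP; rewrite eq_le; apply/andP; split.
  apply: (le_of_cvg_slack xc yc h0); exists (k + l + m).+1 => // n /= bn.
  by apply: (close_match_three t (s_good n)); apply: big bn; lia.
apply: (le_of_cvg_slack yc xc h0); exists (k + l + m).+1 => // n /= bn.
by apply: (close_match_three t (close_matchC (s_good n))); apply: big bn; lia.
Qed.

End BackAndForth.

(** * Operators with the Gurarii property *)

Section Operators.
Variable R : realType.

(** Only homogeneity on [X0] is assumed, because the differences [i' x - i x] are linear on the
    subspace alone. *)
Lemma opnorm_on_bound (X Y : normedModType R) (X0 : {pred X}) (g : X -> Y)
    (c : R) : submod_closed X0 ->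
  (forall t, {in X0, forall x, g (t *: x) = t *: g x}) ->
  (opnorm_on X0 g <= c%:E)%E -> {in X0, forall x, `|g x| <= c * `|x|}.
Proof.
move=> [X0_0 X0_D] gZ gc x xX0; have [->|x_neq0] := eqVneq x 0.
  by rewrite -(scale0r x) gZ // !scale0r !normr0 mulr0.
have x_gt0 : 0 < `|x| by rewrite normr_gt0.
rewrite -ler_pdivrMr // mulrC -[_^-1]ger0_norm ?invr_ge0 // -normrZ -gZ //.
rewrite -lee_fin; apply: le_trans gc; apply: ereal_sup_ubound.
exists (`|x|^-1 *: x) => //; split.
  by rewrite -[_ *: x]addr0 X0_D.
by rewrite normrZ normfV normr_id mulVf // gt_eqF.
Qed.

Lemma opnorm_bound (X Y : normedModType R) (f : {linear X -> Y}) (c : R) :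
  (opnorm f <= c%:E)%E -> forall x, `|f x| <= c * `|x|.
Proof.
by move=> fc x; apply: (opnorm_on_bound (X0 := predT)) => // t u _; exact: linearZ.
Qed.

Lemma opnorm_le1 (X Y : normedModType R) (f : X -> Y) :
  (forall x, `|f x| <= `|x|) -> (opnorm f <= 1)%E.
Proof.
move=> f1; apply: ub_ereal_sup => _ [x [_ x1] <-].
by rewrite lee_fin (le_trans (f1 x)).
Qed.

Lemma linear_onZ (X Y : normedModType R) (X0 : {pred X}) (i : X -> Y) (t : R)
    (x : X) : submod_closed X0 -> linear_on X0 i -> x \in X0 ->
  i (t *: x) = t *: i x.
Proof.
move=> [X0_0 _] lin_i xX0; have := lin_i t x 0 xX0 X0_0; rewrite addr0 => ->.
have := lin_i 1 0 0 X0_0 X0_0; rewrite !scale1r addr0 => /eqP.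
by rewrite -subr_eq subrr eq_sym => /eqP ->; rewrite addr0.
Qed.

Lemma linear_on_proj (Y Z : normedModType R) (X : {pred Y}) (i : Y -> Z)
    (P : {linear Y -> Y}) : linear_on X i -> (forall y, P y \in X) ->
  exists g : {linear Y -> Z}, forall y, g y = i (P y).
Proof.
move=> lin_i PX; apply: exists_linear => t u w.
by rewrite linearP lin_i.
Qed.

(** This is the form in which the Gurarii property delivers extensions: nonexpansive, but agreeing
    with [i] only approximately. *)
Definition almost_extensible (G : normedModType R) : Prop :=
  forall (Y : normedModType R) (X : {pred Y}) (eps : R) (i : Y -> G),
    finite_dim Y -> submod_closed X -> 0 < eps -> isometric_embedding_on X i ->
    exists j : {linear Y -> G},
      eps_embedding eps j /\ {in X, forall x, `|j x - i x| <= eps * `|x|}.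

(* A bounded projection [P] onto [X] turns the approximate extension [k] of [i]
   into the exact extension [k + (i - k) \o P]. *)
Lemma almost_extensible_gurarii (G : completeNormedModType R) :
  separable G -> almost_extensible G -> gurarii_space G.
Proof.
move=> sepG extG; split=> // Y X eps i Yfin Xsub eps_gt0 [lin_i i_isom].
have [P [PX P_id]] := finite_dim_proj Yfin Xsub.
have [C C_ge0 PC] := finite_dim_bounded P Yfin.
have [g gE] := linear_on_proj lin_i PX.
(* The lower bound loses [delta] through [k] and [delta * C] through the correction; their sum is
   made equal to [1 - (1 + eps)^-1]. *)
pose delta := eps / (1 + eps) / (1 + C).
have eps1_gt0 : 0 < 1 + eps by rewrite addr_gt0.
have C1_gt0 : 0 < 1 + C by rewrite ltr_pwDl.
have delta_gt0 : 0 < delta by rewrite !divr_gt0.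
have deltaE : delta + delta * C = 1 - (1 + eps)^-1.
  by rewrite /delta; field; rewrite !gt_eqF.
have delta_inv : 1 - delta <= (1 + delta)^-1.
  rewrite -[leRHS]mul1r ler_pdivlMr ?addr_gt0 //.
  by have : 0 <= delta * delta; [rewrite mulr_ge0 // ltW | lra].
have inv_eps : 1 - (1 + eps)^-1 <= eps.
  have := divr_gt0 eps_gt0 eps1_gt0.
  have -> : 1 - (1 + eps)^-1 = eps / (1 + eps) by field; rewrite gt_eqF.
  by rewrite ler_pdivrMr // ler_peMr ?lerDl // ltW.
have [k [k_emb ki]] := extG Y X delta i Yfin Xsub delta_gt0 (conj lin_i i_isom).
have [j jE] : exists j : {linear Y -> G}, forall y, j y = k y - (k (P y) - g y).
  by exists (k \- ((k \o P) \- g)).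
exists j; split=> [x xX|y]; first by rewrite jE gE P_id // subKr.
have /andP[k_lo k_hi] := k_emb y.
have kP : `|k (P y) - g y| <= delta * C * `|y|.
  by rewrite gE (le_trans (ki _ (PX y))) // -mulrA ler_wpM2l // ltW.
have := ler_normB (k y) (k (P y) - g y).
have := ler_normD (k y - (k (P y) - g y)) (k (P y) - g y); rewrite subrK -jE.
have := ler_wpM2r (normr_ge0 y) delta_inv.
have := ler_wpM2r (normr_ge0 y) inv_eps.
have deltay : delta * `|y| + delta * C * `|y| = `|y| - (1 + eps)^-1 * `|y|.
  by rewrite -mulrDl deltaE mulrBl mul1r.
have dy_ge0 : 0 <= delta * `|y| by rewrite mulr_ge0 // ltW.
move: deltay kP k_lo k_hi dy_ge0; rewrite !mulrBl !mulrDl !mul1r.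
by move=> *; apply/andP; split; lra.
Qed.

(** * Almost extensibility of the codomain and the domain *)

Section GurariiProperty.
Variables (U V : completeNormedModType R) (Omega : {linear U -> V}).
Hypothesis Omega_gurarii : gurarii_property Omega.

Lemma gurarii_property_codomain : almost_extensible V.
Proof.
move=> Y X eps i Yfin Xsub eps_gt0 i_emb; have [lin_i i_isom] := i_emb.
have [T TE] : exists T : {linear Y -> Y}, T =1 fun=> 0.
  by apply: exists_linear => t u w; rewrite scaler0 addr0.
have [X_0 _] := Xsub.
have [||||i' [j' [_ j'_emb _ j'i _]]] := Omega_gurarii.2 eps Y Y T
  (pred1 0) X (fun=> 0) i eps_gt0 Yfin Yfin _ (submod_closed0 Y) Xsub _ _ i_emb _.
- by apply: opnorm_le1 => y; rewrite TE normr0.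
- by move=> x _; rewrite TE.
- split=> [a x y _ _|x]; first by rewrite scaler0 addr0.
  by rewrite inE => /eqP ->; rewrite !normr0.
- move=> x _; rewrite TE linear0; apply/esym/normr0_eq0.
  by rewrite i_isom // normr0.
exists j'; split => //; apply: opnorm_on_bound (ltW j'i) => // t x xX.
by rewrite linearZ scalerBr (linear_onZ _ Xsub).
Qed.

(* Extends [Omega \o i] from [X] to [Y] by a norm-one operator into the pushout
   of [X -> Y] and [Omega \o i]; identifying the pushout with the pairs
   [(y - P y, Omega (i (P y)))] for a projection [P] onto [X] avoids quotients. *)
Lemma gurarii_property_domain : almost_extensible U.
Proof.
move=> Y X eps i Yfin Xsub eps_gt0 i_emb; have [lin_i i_isom] := i_emb.
have [normOmega gurO] := Omega_gurarii.
have [P [PX P_id]] := finite_dim_proj Yfin Xsub.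
have [C C_ge0 PC] := finite_dim_bounded P Yfin.
have [g gE] := linear_on_proj lin_i PX.
have [J JE] : exists J : {linear Y -> V}, forall y, J y = Omega (g y).
  by apply: exists_linear => t u w; rewrite !linearP.
have JP y : `|J y| <= (1 + 0) * `|P y|.
  rewrite addr0 mul1r JE (le_trans (opnorm_bound normOmega _)) // mul1r gE.
  by rewrite i_isom.
(* In the pushout [(P y, - J y)] is zero, so [(y, 0)] has the representative [(y - P y, J y)]. *)
have [L LE] : exists L : {linear Y -> (Y * V)%type}, forall y, L y = (y - P y, J y).
  apply: exists_linear => t u w; rewrite -[RHS]/(_, _) /= !linearP.
  by rewrite addrACA -scalerDr.
have [m [b [bY _]]] := finite_dim_basis Yfin.
pose N := pushnorm P J 0.
have N_D := pushnormD P J (lexx 0); have N_Z := pushnormZ P J (lexx 0).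
have N_eq0 v : N (lincomb (L \o b) v) = 0 -> lincomb (L \o b) v = 0.
  rewrite -linear_lincomb LE; set y := lincomb b v.
  apply: (@pushnorm_eq0 _ _ _ _ _ _ _ (lexx 0) (1 + C)) => [|//|k].
    by rewrite ltr_pwDl.
  (* [y - P y] is fixed by [id - P], which kills [P k] and has norm at most [1 + C]. *)
  have yE : y - P y = (y - P y - P k) - P (y - P y - P k).
    by rewrite !linearB /= !(P_id (P _) (PX _)) subrr sub0r opprK subrK.
  rewrite {1}yE mul0r addr0 mulrDl mul1r (le_trans (ler_normB _ _)) // lerD2l.
  exact: PC.
have [Z [f [Zfin Znorm Lf]]] := normed_span N_D N_Z N_eq0.
have f_inj z w : f z = f w -> z = w.
  move=> fzw; apply/eqP; rewrite -subr_eq0 -normr_eq0 Znorm linearB /= fzw subrr.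
  by rewrite -(scale0r (0 : Y * V)) N_Z normr0 mul0r.
have /choice[T0 T0E] : forall y, exists z, f z = L y.
  move=> y; have [v ->] := bY y; have [z fz] := Lf v; exists z.
  by rewrite fz linear_lincomb.
have [T TE] : exists T : {linear Y -> Z}, T =1 T0.
  by apply: exists_linear => t u w; apply: f_inj; rewrite linearP !T0E linearP.
have fT y : f (T y) = (y - P y, J y) by rewrite TE T0E LE.
(* This is the part of [Z] lying in [V]; it contains [T x] for [x] in [X], since there
   [x - P x = 0]. *)
pose Z0 := [pred z | (f z).1 == 0].
have Z0_sub : submod_closed Z0.
  split=> [|c u w]; first by rewrite inE linear0.
  by rewrite !inE linearP /= => /eqP -> /eqP ->; rewrite scaler0 addr0.
have j_emb : isometric_embedding_on Z0 (fun z => (f z).2).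
  split=> [c u w _ _|z]; first by rewrite linearP.
  rewrite inE => /eqP fz0; rewrite Znorm; case: (f z) fz0 => _ w /= ->.
  by rewrite pushnorm_inr.
have [|||i' [j' [i'_emb _ i'i _ _]]] := gurO eps Y Z T X Z0 i
  (fun z => (f z).2) eps_gt0 Yfin Zfin _ Xsub Z0_sub _ i_emb j_emb _.
- apply: opnorm_le1 => y; rewrite Znorm fT.
  (* Taking [k = - y] returns to the representative [(y, 0)], whose cost is [|y|]. *)
  have := pushnorm_le P J (lexx 0) (y - P y, J y) (- y).
  by rewrite /pushcost /= !linearN /= opprK subrK subrr normr0 mul0r !addr0.
- by move=> x xX; rewrite inE fT /= P_id // subrr.
- by move=> x xX; rewrite fT /= JE gE P_id.
exists i'; split => //; apply: opnorm_on_bound (ltW i'i) => // t x xX.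
by rewrite linearZ scalerBr (linear_onZ _ Xsub).
Qed.

End GurariiProperty.
End Operators.

Theorem theorem4p1 (R : realType) (U V : completeNormedModType R)
    (Omega : {linear U -> V})
    (sepU : separable U) (sepV : separable V)
    (Omega_gurarii : gurarii_property Omega) :
  (exists G : completeNormedModType R, gurarii_space G) /\
  (forall G : completeNormedModType R, gurarii_space G ->
     linearly_isometric U G /\ linearly_isometric V G).
Proof.
have gurU : gurarii_space U.
  apply: almost_extensible_gurarii => //.
  exact: gurarii_property_domain Omega_gurarii.
have gurV : gurarii_space V.
  apply: almost_extensible_gurarii => //.
  exact: gurarii_property_codomain Omega_gurarii.
by split; [exists V | move=> G gurG; split; exact: gurarii_unique].
Qed.
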